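(* Let $l_1,l_2\ge0$ be integers and let $c_{l_1,l_2}\in\mathbb{C}^{(2l_1+1)(2l_2+1)\times(2l_1+1)(2l_2+1)}$ be the matrix of Clebsch-Gordon coefficients for real harmonics, $$c_{l_1,l_2}=(\overline{T^{l_1}}\otimes\overline{T^{l_2}})\,C_{l_1,l_2}\Big[\bigoplus_{l=|l_1-l_2|}^{l_1+l_2}(T^l)^T\Big],$$ with entries $c^{l,m}_{l_1,m_1,l_2,m_2}$ (notation in the context). Then: (1) $c_{l_1,l_2}$ is unitary: $c_{l_1,l_2}\,\overline{c_{l_1,l_2}}^{\,T}=I$. (2) $c^{l,m}_{l_1,m_1,l_2,m_2}=0$ if $|m|\ne|m_1+m_2|$ and $|m|\neq|m_1-m_2|$. (3) The remaining non-zero values, for $m\in\{m_1+m_2,\,-m_1-m_2,\,m_1-m_2,\,-m_1+m_2\}$, are evaluated as follows. Put $\eta=(-1)^{l_1+l_2-l}+1$, $\zeta=(-1)^{l_1+l_2-l}-1$, $a=C^{l,m_1+m_2}_{l_1,m_1,l_2,m_2}$, $b=C^{l,m_1-m_2}_{l_1,m_1,l_2,-m_2}$. (3a) For $\max\{|l_1-l_2|,|m_1+m_2|\}\le l\le l_1+l_2$, the pair $\big(c^{l,m_1+m_2}_{l_1,m_1,l_2,m_2},\ c^{l,-m_1-m_2}_{l_1,m_1,l_2,m_2}\big)$ equals $a$ times: - $m_1=m_2=0$: $(1,\ 1)$; - exactly one of $m_1,m_2$ is zero: $\big(\frac12\eta,\ \frac i2\zeta\big)$; - $m_1>0,\ m_2>0$: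 $\big(\frac1{\sqrt8}\eta,\ \frac{i}{\sqrt8}\zeta\big)$; - $m_1<0,\ m_2>0,\ m_1+m_2>0$: $\big(\frac{i(-1)^{m_1}}{\sqrt8}\zeta,\ -\frac{(-1)^{m_1}}{\sqrt8}\eta\big)$; - $m_1<0,\ m_2>0,\ m_1+m_2=0$: $\big(\frac{i(-1)^{m_1}}{2}\zeta,\ \frac{i(-1)^{m_1}}{2}\zeta\big)$; - $m_1<0,\ m_2>0,\ m_1+m_2<0$: $\big(\frac{(-1)^{m_2}}{\sqrt8}\eta,\ \frac{i(-1)^{m_2}}{\sqrt8}\zeta\big)$; - $m_1<0,\ m_2<0$: $\big(\frac{i}{\sqrt8}\zeta,\ -\frac1{\sqrt8}\eta\big)$; - $m_1>0,\ m_2<0,\ m_1+m_2<0$: $\big(\frac{(-1)^{m_1}}{\sqrt8}\eta,\ \frac{i(-1)^{m_1}}{\sqrt8}\zeta\big)$; - $m_1>0,\ m_2<0,\ m_1+m_2=0$: $\big(\frac{i(-1)^{m_1}}{2}\zeta,\ \frac{i(-1)^{m_1}}{2}\zeta\big)$; - $m_1>0,\ m_2<0,\ m_1+m_2>0$: $\big(\frac{i(-1)^{m_2}}{\sqrt8}\zeta,\ -\frac{(-1)^{m_2}}{\sqrt8}\eta\big)$. (3b) For $\max\{|l_1-l_2|,|m_1-m_2|\}\le l\le l_1+l_2$, the pair $\big(c^{l,m_1-m_2}_{l_1,m_1,l_2,m_2},\ c^{l,-m_1+m_2}_{l_1,m_1,l_2,m_2}\big)$ equals $b$ times: - $m_1=m_2=0$: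 $(1,\ 1)$; - $m_1\neq0,\ m_2=0$: $\big(\frac12\eta,\ \frac i2\zeta\big)$; - $m_1=0,\ m_2\neq0$: $\big(\frac12\eta,\ \frac i2\zeta\big)$; - $m_1>0,\ m_2>0,\ m_1-m_2>0$: $\big(\frac{(-1)^{m_2}}{\sqrt8}\eta,\ \frac{i(-1)^{m_2}}{\sqrt8}\zeta\big)$; - $m_1>0,\ m_2>0,\ m_1-m_2=0$: $\big(\frac{(-1)^{m_1}}{2}\eta,\ \frac{(-1)^{m_1}}{2}\eta\big)$; - $m_1>0,\ m_2>0,\ m_1-m_2<0$: $\big(-\frac{i(-1)^{m_1}}{\sqrt8}\zeta,\ \frac{(-1)^{m_1}}{\sqrt8}\eta\big)$; - $m_1<0,\ m_2>0$: $\big(\frac1{\sqrt8}\eta,\ \frac{i}{\sqrt8}\zeta\big)$; - $m_1<0,\ m_2<0,\ m_1-m_2<0$: $\big(-\frac{i(-1)^{m_2}}{\sqrt8}\zeta,\ \frac{(-1)^{m_2}}{\sqrt8}\eta\big)$; - $m_1<0,\ m_2<0,\ m_1-m_2=0$: $\big(\frac{(-1)^{m_1}}{2}\eta,\ \frac{(-1)^{m_1}}{2}\eta\big)$; - $m_1<0,\ m_2<0,\ m_1-m_2>0$: $\big(\frac{(-1)^{m_1}}{\sqrt8}\eta,\ \frac{i(-1)^{m_1}}{\sqrt8}\zeta\big)$; - $m_1>0,\ m_2<0$: $\big(-\frac{i}{\sqrt8}\zeta,\ \frac1{\sqrt8}\eta\big)$.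
   Context: Indices: $m_1\in\{-l_1,\dots,l_1\}$, $m_2\in\{-l_2,\dots,l_2\}$, $l\in\{|l_1-l_2|,\dots,l_1+l_2\}$, $m\in\{-l,\dots,l\}$, all integers. The matrix $T^l\in\mathbb{C}^{(2l+1)\times(2l+1)}$ (rows and columns indexed from $-l$ to $l$ in ascending order) is the unitary matrix $$T^l_{m,n}=\begin{cases}1&m=n=0,\\0&|m|\ne|n|,\\ (-1)^m/\sqrt2&m>0,\ n=m,\\ 1/\sqrt2&m>0,\ n=-m,\\ i/\sqrt2&m<0,\ n=m,\\ -i(-1)^m/\sqrt2&m<0,\ n=-m.\end{cases}$$ An overline denotes the entrywise complex conjugate, $\otimes$ the Kronecker product, $\bigoplus$ the block-diagonal sum. $C^{l,m}_{l_1,m_1,l_2,m_2}\in\mathbb{R}$ are the standard Clebsch-Gordan coefficients of $SO(3)$ (coupling coefficients for products of Wigner D-matrices $D^l$): $D^{l_1}_{m_1,n_1}D^{l_2}_{m_2,n_2}=\sum_{l=|l_1-l_2|}^{l_1+l_2}\sum_{m,n=-l}^{l}C^{l,m}_{l_1,m_1,l_2,m_2}C^{l,n}_{l_1,n_1,l_2,n_2}D^l_{m,n}$. They satisfy the known properties $\sum_{m_1,m_2}C^{l,m}_{l_1,m_1,l_2,m_2}C^{l',m'}_{l_1,m_1,l_2,m_2}=\delta_{l,l'}\delta_{m,m'}$; $\sum_{l,m}C^{l,m}_{l_1,m_1,l_2,m_2}C^{l,m}_{l_1,m_1',l_2,m_2'}=\delta_{m_1,m_1'}\delta_{m_2,m_2'}$;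 $C^{l,m}_{l_1,m_1,l_2,m_2}=(-1)^{l_1+l_2-l}C^{l,-m}_{l_1,-m_1,l_2,-m_2}$; and $C^{l,m}_{l_1,m_1,l_2,m_2}=0$ if $m\neq m_1+m_2$. The square matrix $C_{l_1,l_2}\in\mathbb{R}^{(2l_1+1)(2l_2+1)\times(2l_1+1)(2l_2+1)}$ collects these coefficients: $C^{l,m}_{l_1,m_1,l_2,m_2}$ is placed (indices counted from $0$) in row $(l_1+m_1)(2l_2+1)+l_2+m_2$ and column $l^2-(l_2-l_1)^2+l+m$. The entries $c^{l,m}_{l_1,m_1,l_2,m_2}$ of $c_{l_1,l_2}$ are indexed by the same rule, so that $$c^{l,m}_{l_1,m_1,l_2,m_2}=\sum_{p_1=-l_1}^{l_1}\sum_{p_2=-l_2}^{l_2}\sum_{p=-l}^{l}\overline{T^{l_1}_{m_1,p_1}}\;\overline{T^{l_2}_{m_2,p_2}}\;T^l_{m,p}\,C^{l,p}_{l_1,p_1,l_2,p_2}.$$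
   Formalization: In (3b), the row m_1=0, m_2≠0 is false as printed (e.g. l_1=0, l_2=l=1, m_2=1, where c is the identity); it is replaced by the correct pair (-(i/2)ζ, (1/2)η) times b. *)

(* Defs.v *)
(* The real numbers are an arbitrary realType R, the complex numbers R[i]. *)
From HB Require Import structures.
From mathcomp Require Import all_boot all_order all_algebra.
From mathcomp Require Import reals trigo.
From mathcomp Require Import mxtens complex.
From mathcomp Require Import zify.

Set Implicit Arguments.
Unset Strict Implicit.
Unset Printing Implicit Defensive.

Import Order.TTheory GRing.Theory Num.Theory.
Local Open Scope ring_scope.
Local Open Scope complex_scope.

(* Position k of 0, ..., 2l stands for the index k - l of -l, ..., l. *)
Definition zidx (l : nat) (k : 'I_l.*2.+1) : int := k%:Z - l%:Z.

(* z! for z >= 0; the value for z < 0 is irrelevant. *)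
Definition ifact (R : realType) (z : int) : R := ((absz z)`!)%:R.

(* D^l_{m,n} in the Euler angles (a, b, g) of the zyz convention:
   D^l_{m,n} = e^{-ima} d^l_{m,n}(b) e^{-ing}, with Wigner's sum for d^l. For
   |m|, |n| <= l the guard on s keeps exactly the terms in which all factorials
   and exponents below have nonnegative arguments. *)
Definition wigner_d (R : realType) (l : nat) (m n : int) (b : R) : R :=
  Num.sqrt (ifact R (l%:Z + m) * ifact R (l%:Z - m)
            * ifact R (l%:Z + n) * ifact R (l%:Z - n))
  * \sum_(s < l.*2.+1 |
            [&& s%:Z <= l%:Z + n, s%:Z <= l%:Z - m & 0 <= m - n + s%:Z])
      (-1) ^ (m - n + s%:Z)
      * cos (b / 2) ^ (l.*2%:Z + n - m - s.*2%:Z)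
      * sin (b / 2) ^ (m - n + s.*2%:Z)
      / (ifact R (l%:Z + n - s%:Z) * ifact R s%:Z
         * ifact R (m - n + s%:Z) * ifact R (l%:Z - m - s%:Z)).

Definition wigner_D (R : realType) (l : nat) (m n : int) (a b g : R) : R[i] :=
  (cos (m%:~R * a) -i* sin (m%:~R * a))
  * (wigner_d l m n b)%:C
  * (cos (n%:~R * g) -i* sin (n%:~R * g)).

(* C l m l1 m1 l2 m2 is the coefficient C^{l,m}_{l1,m1,l2,m2}. The coupling
   relation determines the coefficients up to one sign for each (l1, l2, l),
   which the second clause, the Condon-Shortley convention, fixes. *)
Definition is_clebsch_gordan (R : realType)
    (C : nat -> int -> nat -> int -> nat -> int -> R) : Prop :=
  (forall (l1 l2 : nat) (m1 n1 m2 n2 : int) (a b g : R),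
     `|m1| <= l1%:Z -> `|n1| <= l1%:Z -> `|m2| <= l2%:Z -> `|n2| <= l2%:Z ->
     wigner_D l1 m1 n1 a b g * wigner_D l2 m2 n2 a b g =
     \sum_(`|l1 - l2|%N <= l < (l1 + l2).+1)
       \sum_(p < l.*2.+1) \sum_(q < l.*2.+1)
         (C l (zidx p) l1 m1 l2 m2)%:C * (C l (zidx q) l1 n1 l2 n2)%:C
         * wigner_D l (zidx p) (zidx q) a b g)
  /\
  (forall l1 l2 l : nat, (`|l1 - l2| <= l <= l1 + l2)%N ->
     0 < C l l%:Z l1 l1%:Z l2 (l%:Z - l1%:Z)).

Definition T_entry (R : realType) (m n : int) : R[i] :=
  if (m == 0) && (n == 0) then 1
  else if `|m| != `|n| then 0
  else if 0 < m then
    if n == m then (-1) ^ m / (Num.sqrt 2)%:C else 1 / (Num.sqrt 2)%:C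
  else
    if n == m then 'i%C / (Num.sqrt 2)%:C else - 'i%C * (-1) ^ m / (Num.sqrt 2)%:C.

Definition T_mx (R : realType) (l : nat) : 'M[R[i]]_(l.*2.+1) :=
  \matrix_(j, k) T_entry R (zidx j) (zidx k).

Definition cg_row (l1 l2 : nat) (m1 m2 : int) : int :=
  (l1%:Z + m1) * l2.*2.+1%:Z + l2%:Z + m2.

Definition cg_col (l1 l2 l : nat) (m : int) : int :=
  l%:Z ^+ 2 - (l2%:Z - l1%:Z) ^+ 2 + l%:Z + m.

Definition CG_mx (R : realType)
    (C : nat -> int -> nat -> int -> nat -> int -> R) (l1 l2 : nat) :
    'M[R]_(l1.*2.+1 * l2.*2.+1) :=
  \matrix_(i, j)
    \sum_(k1 < l1.*2.+1) \sum_(k2 < l2.*2.+1)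
    \sum_(`|l1 - l2|%N <= l < (l1 + l2).+1) \sum_(k < l.*2.+1)
      if (i%:Z == cg_row l1 l2 (zidx k1) (zidx k2))
         && (j%:Z == cg_col l1 l2 l (zidx k))
      then C l (zidx k) l1 (zidx k1) l2 (zidx k2) else 0.

(* The degrees l = |l1 - l2|, ..., l1 + l2 are |l1 - l2| + k for
   k = 0, ..., 2 min(l1, l2). *)
Lemma cg_size (l1 l2 : nat) :
  (\sum_(k < (minn l1 l2).*2.+1) (`|l1 - l2| + k).*2.+1 =
   l1.*2.+1 * l2.*2.+1)%N.
Proof.
have S (d n : nat) : (\sum_(k < n) (d + k).*2.+1 = n * (d.*2 + n))%N.
  by elim: n => [|n IH]; rewrite ?big_ord0 // big_ord_recr /= IH; nia.
rewrite S; case: (leqP l1 l2) => h; nia.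
Qed.

Definition cg_real_mx (R : realType)
    (C : nat -> int -> nat -> int -> nat -> int -> R) (l1 l2 : nat) :
    'M[R[i]]_(l1.*2.+1 * l2.*2.+1) :=
  (map_mx Num.conj (T_mx R l1) *t map_mx Num.conj (T_mx R l2))
  *m map_mx (real_complex R) (CG_mx C l1 l2)
  *m castmx (cg_size l1 l2, cg_size l1 l2)
       (\mxdiag_(k < (minn l1 l2).*2.+1) (T_mx R (`|l1 - l2| + k))^T).

(* c^{l,m}_{l1,m1,l2,m2}; the default 0 is never reached for |m1| <= l1,
   |m2| <= l2, |l1 - l2| <= l <= l1 + l2 and |m| <= l. *)
Definition cg_real (R : realType)
    (C : nat -> int -> nat -> int -> nat -> int -> R)
    (l : nat) (m : int) (l1 : nat) (m1 : int) (l2 : nat) (m2 : int) : R[i] :=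
  if (insub `|cg_row l1 l2 m1 m2|%N, insub `|cg_col l1 l2 l m|%N)
    is (Some i, Some j) then cg_real_mx C l1 l2 i j else 0.

(* Main.v *)
Require Import Defs.
From mathcomp Require Import all_boot all_order all_algebra.
From mathcomp Require Import reals trigo mxtens complex.
From mathcomp Require Import zify ring lra.

(** Write A for the Clebsch-Gordan matrix, with rows indexed by (m1, m2) and
    columns by (l, m), and D^l for the matrix of Wigner functions. The coupling
    relation says, for all Euler angles, that

      D^{l1} (x) D^{l2} = A W A^T,   W = the block-diagonal sum of the D^l

    ([coupling_mx]). Everything needed about the coefficients follows by
    evaluating this identity at three kinds of rotations, where the D^l are
    explicit:
    - at the identity all D^l are 1, so A A^T = 1 ([CG_mx_orthogonal]); since A
      is square, A^T A = 1 as well, and the coupling relation becomes the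
      intertwining relation (D^{l1} (x) D^{l2}) A = A W ([wigner_intertwine]);
    - at (a, 0, 0) the D^l are diagonal with entries e^{-ima}, so a coefficient
      survives only if e^{-i(m1 + m2)a} = e^{-ima} for all a, that is
      m = m1 + m2 ([clebsch_gordan_selection]);
    - at (0, pi, 0) the D^l are antidiagonal with entries (-1)^{l+m}, which
      gives the sign (-1)^{l1+l2-l} under negation of m1, m2, m
      ([clebsch_gordan_symmetry]).

    The real coefficients are then a finite computation. Unitarity holds because
    c is a product of unitary matrices ([cg_real_mx_unitary]). An entry c is the
    sum of conj(T_{m1,p1}) conj(T_{m2,p2}) T_{m,p} C^{l,p}_{p1,p2}, and T_{m,p}
    vanishes unless p = m or p = -m. Together with p = p1 + p2 this leaves at
    most one triple (p1, p2, p) and its negative. By the symmetry of C and by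
    T_{m,-p} = (-1)^p conj(T_{m,p}) the two terms combine to

      C^{l,p}_{p1,p2} (X + (-1)^{l1+l2-l} conj X),
      X = conj(T_{m1,p1}) conj(T_{m2,p2}) T_{m,p}

    ([cg_real_two_terms]). Since X is real or purely imaginary, every value with
    (m1, m2) <> (0, 0) is a multiple of eta or of zeta. *)

Set Implicit Arguments.
Unset Strict Implicit.
Unset Printing Implicit Defensive.

Import Order.TTheory GRing.Theory Num.Theory.
Local Open Scope ring_scope.
Local Open Scope complex_scope.

(** * Row and column indices *)

Lemma big_only (V : nmodType) (I : finType) (i0 : I) (F : I -> V) :
  (forall i, i != i0 -> F i = 0) -> \sum_i F i = F i0.
Proof. by move=> F0; rewrite (bigD1 i0) //= big1 ?addr0. Qed.

Lemma zidx_inj (l : nat) : injective (@zidx l).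
Proof. by move=> j k; rewrite /zidx => h; apply: val_inj => /=; lia. Qed.

Lemma zidx_le (l : nat) (k : 'I_l.*2.+1) : `|zidx k| <= l%:Z.
Proof. by have := ltn_ord k; rewrite /zidx; lia. Qed.

Lemma zidx_surj (l : nat) (m : int) :
  `|m| <= l%:Z -> {k : 'I_l.*2.+1 | zidx k = m}.
Proof.
move=> hm; have hk : (absz (l%:Z + m)%R < l.*2.+1)%N by lia.
by exists (Ordinal hk); rewrite /zidx /=; lia.
Qed.

Lemma cg_rowE (l1 l2 : nat) (k1 : 'I_l1.*2.+1) (k2 : 'I_l2.*2.+1) :
  cg_row l1 l2 (zidx k1) (zidx k2) = (mxtens_index (k1, k2))%:Z.
Proof. rewrite /cg_row /zidx /=; lia. Qed.

Lemma eq_cg_row (l1 l2 : nat) (k1 k1' : 'I_l1.*2.+1) (k2 k2' : 'I_l2.*2.+1) :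
  ((mxtens_index (k1, k2))%:Z == cg_row l1 l2 (zidx k1') (zidx k2')) =
  (k1 == k1') && (k2 == k2').
Proof.
by rewrite cg_rowE eqz_nat -xpair_eqE -(can_eq (@mxtens_indexK _ _)).
Qed.

(** * The Clebsch-Gordan matrix as a row of blocks, one for each degree *)

Section Blocks.
Variables (R : realType) (C : nat -> int -> nat -> int -> nat -> int -> R).
Variables (l1 l2 : nat).
Local Notation d := `|l1 - l2|%N.
Local Notation n := (minn l1 l2).*2.+1.

(** Column j of the block of degree |l1 - l2| + k. *)
Definition block_col (k : 'I_n) (j : 'I_(d + k).*2.+1) :
    'I_(l1.*2.+1 * l2.*2.+1) :=
  cast_ord (cg_size l1 l2)
    (tagnat.Rank (p_ := fun k : 'I_n => (d + k).*2.+1) k j).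

(** The blocks before the k-th have total width k (2 |l1 - l2| + k), and this is
    l^2 - (l2 - l1)^2 for l = |l1 - l2| + k. *)
Lemma block_colE (k : 'I_n) (j : 'I_(d + k).*2.+1) :
  cg_col l1 l2 (d + k) (zidx j) = (block_col j)%:Z.
Proof.
have val_col : block_col j = (k * (d.*2 + k) + j)%N :> nat.
  rewrite [LHS]tagnat.RankEsum; congr (_ + _)%N.
  rewrite -(big_ord_widen n (fun i => (d + i).*2.+1)) ?(ltnW (ltn_ord k)) //.
  elim: (nat_of_ord k) => [|e IH]; first by rewrite big_ord0.
  by rewrite big_ord_recr /= IH; lia.
have dE : (l2%:Z - l1%:Z) ^+ 2 = d%:Z ^+ 2.
  by rewrite abszE -normrX ger0_norm ?sqr_ge0 // -sqrrN opprB.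
rewrite val_col /cg_col /zidx dE; move: (nat_of_ord j) => {val_col j} j.
move: (nat_of_ord k) => {k} k.
by rewrite !PoszD PoszM -addnn !PoszD; ring.
Qed.

Definition cg_block (l : nat) : 'M[R[i]]_(l1.*2.+1 * l2.*2.+1, l.*2.+1) :=
  \matrix_(i, j) let ks := mxtens_unindex i in
    (C l (zidx j) l1 (zidx ks.1) l2 (zidx ks.2))%:C.

(** Degree l occupies the columns l^2, ..., (l + 1)^2 - 1, up to a shift that
    does not depend on l, so different degrees use disjoint columns. *)
Lemma cg_col_inj (l l' : nat) (k : 'I_l.*2.+1) (k' : 'I_l'.*2.+1) :
  cg_col l1 l2 l (zidx k) = cg_col l1 l2 l' (zidx k') ->
  l = l' /\ k = k' :> nat.
Proof.
have : (k <= l.*2)%N by have := ltn_ord k.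
have : (k' <= l'.*2)%N by have := ltn_ord k'.
rewrite /cg_col /zidx.
move: (nat_of_ord k) (nat_of_ord k') => {k k'} k k' hk' hk.
move=> e; have {}e : (l ^ 2 + k = l' ^ 2 + k')%N by lia.
case: (ltngtP l l') e => [h|h|->] e; last by split=> //; lia.
- have : (l.+1 ^ 2 <= l' ^ 2)%N by rewrite leq_exp2r.
  by rewrite -addn1 sqrnD; lia.
- have : (l'.+1 ^ 2 <= l ^ 2)%N by rewrite leq_exp2r.
  by rewrite -addn1 sqrnD; lia.
Qed.

Lemma block_colP (j : 'I_(l1.*2.+1 * l2.*2.+1)) :
  exists (k : 'I_n), exists j' : 'I_(d + k).*2.+1, j = block_col j'.
Proof.
pose s := cast_ord (esym (cg_size l1 l2)) j.
exists (tagnat.sig1 s); exists (tagnat.sig2 s).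
by rewrite /block_col tagnat.sig2K; apply: val_inj.
Qed.

(** The quadruple sum in the definition of [CG_mx] is a lookup: the index maps
    are injective, so one summand has the requested position. *)
Lemma CG_mxE (k1 : 'I_l1.*2.+1) (k2 : 'I_l2.*2.+1) (k : 'I_n)
    (j : 'I_(d + k).*2.+1) :
  CG_mx C l1 l2 (mxtens_index (k1, k2)) (block_col j) =
  C (d + k)%N (zidx j) l1 (zidx k1) l2 (zidx k2).
Proof.
have hk : ((d + k)%N \in index_iota `|l1 - l2| (l1 + l2).+1).
  by have := ltn_ord k; rewrite mem_index_iota; lia.
rewrite mxE (big_only (i0 := k1)); last first.
  move=> x nx; apply: big1 => y _; apply: big1_seq => l _; apply: big1 => z _.
  by rewrite eq_cg_row [_ == x]eq_sym (negbTE nx) ?andbF.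
rewrite (big_only (i0 := k2)); last first.
  move=> y ny; apply: big1_seq => l _; apply: big1 => z _.
  by rewrite eq_cg_row [_ == y]eq_sym (negbTE ny) ?andbF.
rewrite (bigD1_seq _ hk (iota_uniq _ _)) /= [X in _ + X]big1 ?addr0; last first.
  move=> l nl; apply: big1 => z _; rewrite -block_colE.
  case: ifP => // /andP[_ /eqP /cg_col_inj [e]].
  by rewrite e eqxx in nl.
rewrite (big_only (i0 := j)) ?eq_cg_row -?block_colE ?eqxx // => z nz.
case: ifP => // /andP[_ /eqP /cg_col_inj [_ e]].
by case/eqP: nz; apply: val_inj.
Qed.

Lemma castmx_mxrowE (T : Type) (m : nat)
    (B : forall k : 'I_n, 'M[T]_(m, (d + k).*2.+1))
    (i : 'I_m) (k : 'I_n) (j : 'I_(d + k).*2.+1) :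
  castmx (erefl, cg_size l1 l2) (\mxrow_(k < n) B k) i (block_col j) = B k i j.
Proof.
rewrite castmxE cast_ord_id /block_col cast_ordK.
by have /matrixP/(_ i j) := mxrowK B k; rewrite mxE.
Qed.

Lemma map_CG_mx :
  map_mx (real_complex R) (CG_mx C l1 l2) =
  castmx (erefl, cg_size l1 l2) (\mxrow_(k < n) cg_block (d + k)).
Proof.
apply/matrixP => i j; case: (mxtens_indexP i) => k1 k2.
have [k [j' ->]] := block_colP j.
by rewrite castmx_mxrowE mxE CG_mxE mxE mxtens_indexK.
Qed.
End Blocks.

(** * Wigner functions at the identity and at the rotation by pi *)

Lemma ifact0 (R : realType) : ifact R 0 = 1.
Proof. by []. Qed.

Lemma ifact_neq0 (R : realType) z : ifact R z != 0.
Proof. by rewrite pnatr_eq0 -lt0n fact_gt0. Qed.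

(** With sin 0 = 0, a term survives only if its exponent m - n + 2s is 0, which
    forces s = 0 and m = n. *)
Lemma wigner_d_0 (R : realType) (l : nat) (m n : int) :
  `|m| <= l%:Z -> `|n| <= l%:Z -> wigner_d l m n (0 : R) = (m == n)%:R.
Proof.
move=> hm hn; rewrite /wigner_d mul0r cos0 sin0.
case: (eqVneq m n) => [<-|mn]; last first.
  rewrite big1 ?mulr0 // => s /and3P[_ _ hs].
  by rewrite exp1rz exp0rz (_ : _ == 0 = false) ?mulr0 ?mul0r //; lia.
rewrite (bigD1 ord0) /=; last by apply/and3P; split; lia.
rewrite big1 ?addr0; last first.
  move=> s /andP[_ s0].
  rewrite exp1rz exp0rz (_ : _ == 0 = false) ?mulr0 ?mul0r //.
  by have : s != 0%N :> nat by []; lia.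
rewrite subrr exp1rz !expr0z !mul1r ?[_ 0%N%:Z]ifact0 ?ifact0 ?mulr1.
set x := ifact _ _; set y := ifact _ _.
have -> : x * y * x * y = (x * y) ^+ 2 by ring.
rewrite sqrtr_sqr ger0_norm ?mulr_ge0 ?ler0n // mulfV //.
by rewrite mulf_neq0 ?ifact_neq0.
Qed.

(** With cos (pi / 2) = 0, a term survives only if its exponent
    (l + n - s) + (l - m - s) is 0; both summands are nonnegative, so
    s = l + n = l - m. *)
Lemma wigner_d_pi (R : realType) (l : nat) (m n : int) :
  `|m| <= l%:Z -> `|n| <= l%:Z ->
  wigner_d l m n (pi : R) = (-1) ^ (l%:Z + m) *+ (m == - n).
Proof.
move=> hm hn; rewrite /wigner_d cos_pihalf sin_pihalf.
case: (eqVneq m (- n)) => [->|mn]; last first.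
  rewrite big1 ?mulr0 // => s /and3P[hs1 hs2 hs].
  rewrite exp0rz (_ : _ == 0 = false) ?mulr0 ?mul0r //; lia.
have hs : (absz (l%:Z + n)%R < l.*2.+1)%N by lia.
rewrite (bigD1 (Ordinal hs)) /=; last by apply/and3P; split; lia.
rewrite big1 ?addr0; last first.
  move=> s /andP[/and3P[h1 h2 h3] s0].
  rewrite exp0rz (_ : _ == 0 = false) ?mulr0 ?mul0r //.
  by have : s != absz (l%:Z + n)%R :> nat by []; lia.
have -> : (absz (l%:Z + n)%R)%:Z = l%:Z + n by lia.
have -> : l.*2%:Z + n - - n - (absz (l%:Z + n)%R).*2%:Z = 0 by lia.
have -> : - n - n + (l%:Z + n) = l%:Z - n by ring.
have -> : l%:Z - - n - (l%:Z + n) = 0 by ring.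
have lln : l%:Z - - n = l%:Z + n by rewrite opprK.
rewrite lln subrr expr0z exp1rz ?ifact0 ?mul1r ?mulr1 mulr1n.
set x := ifact _ _; set y := ifact _ _.
have -> : x * y * y * x = (y * x) ^+ 2 by ring.
rewrite sqrtr_sqr ger0_norm ?mulr_ge0 ?ler0n // mulrCA mulfV ?mulr1 //.
by rewrite mulf_neq0 ?ifact_neq0.
Qed.

(** * The coupling relation as a matrix identity *)

Lemma castmxr_mulmx (T : pzRingType) (m q q' : nat) (e : q = q')
    (M : 'M[T]_(m, q)) (W : 'M[T]_q) :
  castmx (erefl m, e) M *m castmx (e, e) W = castmx (erefl m, e) (M *m W).
Proof. by case: q' / e; rewrite !castmx_id. Qed.

Lemma castmxr_mulmx_tr (T : pzRingType) (m p q q' : nat) (e : q = q')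
    (M : 'M[T]_(m, q)) (N : 'M[T]_(p, q)) :
  castmx (erefl m, e) M *m (castmx (erefl p, e) N)^T = M *m N^T.
Proof. by case: q' / e; rewrite !castmx_id. Qed.

Lemma mulmx_castmxr (T : pzRingType) (m p q q' : nat) (e : q = q')
    (M : 'M[T]_(p, m)) (N : 'M[T]_(m, q)) :
  M *m castmx (erefl m, e) N = castmx (erefl p, e) (M *m N).
Proof. by case: q' / e; rewrite !castmx_id. Qed.

Lemma tensmx11 (T : pzRingType) m p : 1%:M *t 1%:M = 1%:M :> 'M[T]_(m * p).
Proof.
apply/matrixP => i j.
case: (mxtens_indexP i) => i1 i2; case: (mxtens_indexP j) => j1 j2.
rewrite tensmxE !mxE (can_eq (@mxtens_indexK _ _)) xpair_eqE.
by case: eqP => _; rewrite ?mul1r ?mul0r.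
Qed.

Lemma phaseM (R : realType) (x y : R) :
  (cos x -i* sin x) * (cos y -i* sin y) = (cos (x + y) -i* sin (x + y)) :> R[i].
Proof. by rewrite cosD sinD; congr Complex; ring. Qed.

Section Coupling.
Variables (R : realType) (C : nat -> int -> nat -> int -> nat -> int -> R).
Variables (l1 l2 : nat).
Local Notation d := `|l1 - l2|%N.
Local Notation n := (minn l1 l2).*2.+1.
Local Notation A := (map_mx (real_complex R) (CG_mx C l1 l2)).

Definition degree_blocks (W : forall l, 'M[R[i]]_(l.*2.+1)) :
    'M[R[i]]_(l1.*2.+1 * l2.*2.+1) :=
  castmx (cg_size l1 l2, cg_size l1 l2) (\mxdiag_(k < n) W (d + k)%N).

Lemma CG_mulmx_blocks (W : forall l, 'M[R[i]]_(l.*2.+1)) :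
  A *m degree_blocks W =
  castmx (erefl, cg_size l1 l2)
    (\mxrow_(k < n) (cg_block C l1 l2 (d + k) *m W (d + k)%N)).
Proof.
by rewrite map_CG_mx castmxr_mulmx mul_mxrow_mxdiag.
Qed.

Lemma CG_sandwich (W : forall l, 'M[R[i]]_(l.*2.+1)) :
  A *m degree_blocks W *m A^T =
  \sum_(k < n) cg_block C l1 l2 (d + k) *m W (d + k)%N
               *m (cg_block C l1 l2 (d + k))^T.
Proof.
rewrite CG_mulmx_blocks map_CG_mx castmxr_mulmx_tr tr_mxrow.
exact: mul_mxrow_mxcol.
Qed.

Lemma blocks1 : degree_blocks (fun l => 1%:M) = 1%:M.
Proof.
rewrite /degree_blocks mxdiagZ.
by case: _ / (cg_size l1 l2); rewrite castmx_id.
Qed.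

Definition wigner_mx (a b g : R) (l : nat) : 'M[R[i]]_(l.*2.+1) :=
  \matrix_(j, k) wigner_D l (zidx j) (zidx k) a b g.

Hypothesis hC : is_clebsch_gordan C.

Lemma coupling_mx (a b g : R) :
  wigner_mx a b g l1 *t wigner_mx a b g l2 =
  A *m degree_blocks (wigner_mx a b g) *m A^T.
Proof.
rewrite CG_sandwich; apply/matrixP => i j.
case: (mxtens_indexP i) => j1 j2; case: (mxtens_indexP j) => k1 k2.
rewrite tensmxE !mxE hC.1 ?zidx_le // summxE.
rewrite -{1}[`|l1 - l2|%N]add0n big_addn big_mkord.
have -> : ((l1 + l2).+1 - `|l1 - l2|)%N = n by lia.
apply: eq_bigr => k _; rewrite addnC mxE exchange_big /=.
apply: eq_bigr => q _; rewrite !mxE mulr_suml mxtens_indexK /=.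
by apply: eq_bigr => p _; rewrite !mxE mxtens_indexK /= mulrAC.
Qed.

Lemma wigner_mx0 l : wigner_mx 0 0 0 l = 1%:M.
Proof.
apply/matrixP => j k; rewrite !mxE /wigner_D wigner_d_0 ?zidx_le //.
rewrite !mulr0 cos0 sin0 (inj_eq (@zidx_inj l)).
by rewrite oppr0 mul1r mulr1 (rmorph_nat (real_complex R)).
Qed.

(** The coupling relation at the identity rotation. *)
Lemma CG_mx_orthogonal : A *m A^T = 1%:M.
Proof.
have := coupling_mx 0 0 0.
have -> : degree_blocks (wigner_mx 0 0 0) = 1%:M.
  by rewrite -blocks1; congr castmx; apply: eq_mxdiag => k; apply: wigner_mx0.
by rewrite !wigner_mx0 tensmx11 mulmx1.
Qed.

(** Multiply the coupling relation by A on the right, use A^T A = 1, and read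
    off the block of one degree. *)
Lemma wigner_intertwine (a b g : R) (k : 'I_n) :
  (wigner_mx a b g l1 *t wigner_mx a b g l2) *m cg_block C l1 l2 (d + k) =
  cg_block C l1 l2 (d + k) *m wigner_mx a b g (d + k).
Proof.
have : (wigner_mx a b g l1 *t wigner_mx a b g l2) *m A =
       A *m degree_blocks (wigner_mx a b g).
  by rewrite coupling_mx -!mulmxA (mulmx1C CG_mx_orthogonal) mulmx1.
rewrite CG_mulmx_blocks map_CG_mx mulmx_castmxr.
move/(can_inj (castmxK (erefl _) (cg_size l1 l2))).
by rewrite mul_mxrow => /eq_mxrowP; apply.
Qed.

Lemma wigner_intertwineE (a b g : R) (l : nat) (k1 : 'I_l1.*2.+1)
    (k2 : 'I_l2.*2.+1) (j : 'I_l.*2.+1) :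
  (`|l1 - l2| <= l <= l1 + l2)%N ->
  \sum_(p1 < l1.*2.+1) \sum_(p2 < l2.*2.+1)
    wigner_D l1 (zidx k1) (zidx p1) a b g
    * wigner_D l2 (zidx k2) (zidx p2) a b g
    * (C l (zidx j) l1 (zidx p1) l2 (zidx p2))%:C =
  \sum_(p < l.*2.+1) (C l (zidx p) l1 (zidx k1) l2 (zidx k2))%:C
     * wigner_D l (zidx p) (zidx j) a b g.
Proof.
move=> hl; have hk : (l - d < n)%N by lia.
have lE : (d + Ordinal hk)%N = l by rewrite /=; lia.
case: _ / lE j => j.
transitivity (((wigner_mx a b g l1 *t wigner_mx a b g l2)
               *m cg_block C l1 l2 (d + Ordinal hk)) (mxtens_index (k1, k2)) j).
  rewrite mxE pair_bigA [RHS](reindex (@mxtens_index _ _)) /=; last first.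
    by exists (@mxtens_unindex _ _) => x _;
      rewrite ?mxtens_indexK ?mxtens_unindexK.
  by apply: eq_bigr => -[p1 p2] _; rewrite tensmxE !mxE mxtens_indexK.
rewrite wigner_intertwine mxE.
by apply: eq_bigr => p _; rewrite !mxE mxtens_indexK.
Qed.

(** * Selection rule and symmetry of the Clebsch-Gordan coefficients *)

(** At (a, 0, 0) the intertwining relation reads
    e^{-i(m1 + m2)a} c = c e^{-ima}. The angle a = pi / (m - m1 - m2) makes the
    two phases opposite, hence c = 0. *)
Lemma clebsch_gordan_selection (l : nat) (m1 m2 m : int) :
  (`|l1 - l2| <= l <= l1 + l2)%N ->
  `|m1| <= l1%:Z -> `|m2| <= l2%:Z -> `|m| <= l%:Z ->
  m != m1 + m2 -> C l m l1 m1 l2 m2 = 0.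
Proof.
move=> hl /zidx_surj[k1 <-] /zidx_surj[k2 <-] /zidx_surj[j <-] ne.
set q := zidx k1 + zidx k2 in ne *.
have q0 : (zidx j - q)%:~R != 0 :> R by rewrite intr_eq0 subr_eq0.
pose a : R := pi / (zidx j - q)%:~R.
have := wigner_intertwineE a 0 0 k1 k2 j hl.
have Da l' (x y : 'I_l'.*2.+1) :
    wigner_D l' (zidx x) (zidx y) a 0 0 =
    (cos ((zidx x)%:~R * a) -i* sin ((zidx x)%:~R * a)) *+ (x == y).
  rewrite /wigner_D wigner_d_0 ?zidx_le // mulr0 cos0 sin0 oppr0 mulr1.
  by rewrite (inj_eq (@zidx_inj l')) (rmorph_nat (real_complex R)) mulr_natr.
rewrite (big_only (i0 := k1)); last first.
  move=> x nx; apply: big1 => y _.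
  by rewrite Da [_ == x]eq_sym (negbTE nx) !mul0r.
rewrite (big_only (i0 := k2)); last first.
  by move=> y ny; rewrite !Da [_ == y]eq_sym (negbTE ny) mulr0 mul0r.
rewrite (big_only (i0 := j)); last by move=> x nx; rewrite Da (negbTE nx) mulr0.
rewrite !Da !eqxx !mulr1n.
set c := C _ _ _ _ _ _.
have -> : (zidx j)%:~R * a = q%:~R * a + pi.
  have <- : (zidx j - q)%:~R * a = pi by rewrite mulrC divfK.
  by rewrite -mulrDl -intrD addrC subrK.
have -> : q%:~R * a = (zidx k1)%:~R * a + (zidx k2)%:~R * a.
  by rewrite intrD mulrDl.
rewrite phaseM cosDpi sinDpi; set x := _ + _.
move=> /eqP; rewrite eq_complex /= => /andP[/eqP ec /eqP es].
have := cos2Dsin2 x => cs.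
have {}ec : c * cos x = 0 by lra.
have {}es : c * sin x = 0 by lra.
by rewrite -[c]mulr1 -cs mulrDr !expr2 !mulrA ec es !mul0r addr0.
Qed.

(** At (0, pi, 0) the intertwining relation reads
    (-1)^{l1 + m1} (-1)^{l2 + m2} C^{l,-m}_{-m1,-m2}
    = C^{l,m}_{m1,m2} (-1)^{l + m}. When m = m1 + m2 the signs combine to
    (-1)^{l1 + l2 - l}; otherwise both coefficients vanish. *)
Lemma clebsch_gordan_symmetry (l : nat) (m1 m2 m : int) :
  (`|l1 - l2| <= l <= l1 + l2)%N ->
  `|m1| <= l1%:Z -> `|m2| <= l2%:Z -> `|m| <= l%:Z ->
  C l (- m) l1 (- m1) l2 (- m2) = (-1) ^+ (l1 + l2 - l) * C l m l1 m1 l2 m2.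
Proof.
move=> hl hm1 hm2 hm.
have [ne|/eqP mE] := boolP (m != m1 + m2).
  by rewrite !clebsch_gordan_selection ?mulr0 ?normrN // -opprD eqr_opp.
have [k1 k1E] := zidx_surj hm1; have [k2 k2E] := zidx_surj hm2.
have [p pE] := zidx_surj hm.
have /zidx_surj[k1' k1'E] : `|- m1| <= l1%:Z by rewrite normrN.
have /zidx_surj[k2' k2'E] : `|- m2| <= l2%:Z by rewrite normrN.
have /zidx_surj[j jE] : `|- m| <= l%:Z by rewrite normrN.
have := wigner_intertwineE 0 pi 0 k1 k2 j hl.
have Dpi l' (x y : 'I_l'.*2.+1) :
    wigner_D l' (zidx x) (zidx y) 0 pi 0 =
    ((-1) ^ (l'%:Z + zidx x) *+ (zidx x == - zidx y))%:C :> R[i].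
  rewrite /wigner_D wigner_d_pi ?zidx_le // !mulr0 cos0 sin0 oppr0.
  by rewrite mul1r mulr1.
rewrite (big_only (i0 := k1')); last first.
  move=> x nx; apply: big1 => y _.
  rewrite Dpi k1E -eqr_oppLR -k1'E (inj_eq (@zidx_inj l1)) [_ == x]eq_sym.
  by rewrite (negbTE nx) !mul0r.
rewrite (big_only (i0 := k2')); last first.
  move=> y ny; rewrite !Dpi k2E -[_ == - zidx y]eqr_oppLR -k2'E.
  by rewrite (inj_eq (@zidx_inj l2)) [_ == y]eq_sym (negbTE ny) mulr0 mul0r.
rewrite (big_only (i0 := p)); last first.
  move=> x nx; rewrite Dpi jE opprK -pE (inj_eq (@zidx_inj l)) (negbTE nx).
  by rewrite mulr0.
rewrite !Dpi k1E k2E k1'E k2'E pE jE !opprK !eqxx !mulr1n -!rmorphM.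
move=> /complexI.
rewrite -expfzDr ?oppr_eq0 ?oner_eq0 //.
have -> : l1%:Z + m1 + (l2%:Z + m2) = (l1 + l2 - l)%N%:Z + (l%:Z + m) by lia.
rewrite expfzDr ?oppr_eq0 ?oner_eq0 // [in RHS]mulrC -mulrA [RHS]mulrC.
rewrite [X in _ * X = _]mulrC mulrA.
move/(mulIf _) => <-; last by rewrite expfz_neq0 ?oppr_eq0 ?oner_eq0.
by rewrite exprnP mulrA -expfzMl mulrNN mulr1 exp1rz mul1r.
Qed.
End Coupling.

(** * The change of basis to real harmonics *)

Section RealHarmonics.
Variable R : realType.
Local Notation r2 := ((Num.sqrt 2)%:C : R[i]).
Local Notation T := (T_entry R).

Lemma sqrt2C_sqr : r2 ^+ 2 = 2.
Proof.
by rewrite -rmorphXn /= sqr_sqrtr ?ler0n // (rmorph_nat (real_complex R)).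
Qed.

Lemma sqrt2C_neq0 : r2 != 0.
Proof. by rewrite -sqrf_eq0 sqrt2C_sqr pnatr_eq0. Qed.

Lemma T_entry_eq0 (m n : int) : `|m| != `|n| -> T m n = 0.
Proof.
move=> h; rewrite /T_entry h; case: ifP => // /andP[/eqP m0 /eqP n0].
by rewrite m0 n0 eqxx in h.
Qed.

Lemma sqrt8C : (Num.sqrt 8)%:C = 2 * r2.
Proof.
rewrite (_ : 8 = 2 ^+ 2 * 2 :> R); last by ring.
rewrite sqrtrM ?exprn_ge0 ?ler0n // sqrtr_sqr ger0_norm ?ler0n //.
by rewrite rmorphM /= (rmorph_nat (real_complex R)).
Qed.

Lemma imag_sqr : 'i%C * 'i%C = - 1 :> R[i].
Proof. by rewrite -expr2 sqr_i. Qed.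

Lemma T_entry00 : T 0 0 = 1.
Proof. by []. Qed.

Lemma conj_realC (x : R) : Num.conj x%:C = x%:C.
Proof. exact: conjc_real. Qed.

Lemma conj_i : Num.conj 'i%C = - 'i%C :> R[i].
Proof. by rewrite [LHS]/(conjc _) /= -[RHS]/(Complex _ _) oppr0. Qed.

Lemma conj_signz (m : int) : Num.conj ((-1) ^ m) = (-1) ^ m :> R[i].
Proof. by rewrite rmorphXz ?rmorphN1 // unitrN1. Qed.

Lemma signz_sqr (m : int) : (-1) ^ m * (-1) ^ m = 1 :> R[i].
Proof. by rewrite -expfzMl mulrNN mulr1 exp1rz. Qed.

Lemma signzD (m n : int) : (-1) ^ (m + n) = (-1) ^ m * (-1) ^ n :> R[i].
Proof. by rewrite expfzDr ?oppr_eq0 ?oner_eq0. Qed.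

Lemma conj_div_sqrt2 (z : R[i]) : Num.conj (z / r2) = Num.conj z / r2.
Proof. by rewrite rmorphM fmorphV /= conj_realC. Qed.

Lemma signzN (m : int) : (-1) ^ (- m) = (-1) ^ m :> R[i].
Proof. by rewrite -exprz_inv invrN1. Qed.

(** A table for rewriting. The conjugates form its first component because they
    have to be rewritten before the entries inside them. *)
Lemma T_entry_pos (m : int) : 0 < m ->
  ((Num.conj (T m m) = (-1) ^ m / r2) * (Num.conj (T m (- m)) = 1 / r2) *
   (Num.conj (T (- m) m) = 'i%C * (-1) ^ m / r2) *
   (Num.conj (T (- m) (- m)) = - 'i%C / r2)) *
  ((T m m = (-1) ^ m / r2) * (T m (- m) = 1 / r2) *
   (T (- m) m = - 'i%C * (-1) ^ m / r2) * (T (- m) (- m) = 'i%C / r2)).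
Proof.
move=> h; have m0 : (m == 0) = false by lia.
have mN0 : (- m == 0) = false by lia.
have mm : (- m == m) = false by lia.
have mm' : (m == - m) = false by lia.
have h' : (0 < - m) = false by lia.
have E1 : T m m = (-1) ^ m / r2 by rewrite /T_entry m0 h !eqxx.
have E2 : T m (- m) = 1 / r2 by rewrite /T_entry m0 h mm normrN !eqxx.
have E3 : T (- m) m = - 'i%C * (-1) ^ m / r2.
  by rewrite /T_entry m0 mN0 h' mm' normrN !eqxx signzN.
have E4 : T (- m) (- m) = 'i%C / r2 by rewrite /T_entry mN0 h' !eqxx.
rewrite E1 E2 E3 E4 !conj_div_sqrt2 rmorphM rmorphN /= conj_signz !conj_i opprK.
by rewrite conjC1.
Qed.

Lemma T_entry_neg (m : int) : m < 0 ->
  ((Num.conj (T m m) = - 'i%C / r2) *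
   (Num.conj (T m (- m)) = 'i%C * (-1) ^ m / r2) *
   (Num.conj (T (- m) m) = 1 / r2) *
   (Num.conj (T (- m) (- m)) = (-1) ^ m / r2)) *
  ((T m m = 'i%C / r2) * (T m (- m) = - 'i%C * (-1) ^ m / r2) *
   (T (- m) m = 1 / r2) * (T (- m) (- m) = (-1) ^ m / r2)).
Proof.
rewrite -oppr_gt0 => /T_entry_pos; rewrite opprK signzN.
by move=> [[[[E1 E2] E3] E4] [[[E5 E6] E7] E8]].
Qed.

Lemma sum_T_entry (l : nat) (m : int) (F : int -> R[i]) : `|m| <= l%:Z ->
  \sum_(p < l.*2.+1) T m (zidx p) * F (zidx p) =
  if m == 0 then F 0 else T m m * F m + T m (- m) * F (- m).
Proof.
move=> hm; have [k kE] := zidx_surj hm.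
have /zidx_surj[k' k'E] : `|- m| <= l%:Z by rewrite normrN.
have T0 p : p != k -> p != k' -> T m (zidx p) = 0.
  rewrite -!(inj_eq (@zidx_inj l)) kE k'E => ne ne'.
  by apply: T_entry_eq0; lia.
case: eqP => [m0|/eqP m0].
  rewrite (big_only (i0 := k)) ?kE m0 ?T_entry00 ?mul1r // => p pk.
  rewrite -m0 T0 ?mul0r // -(inj_eq (@zidx_inj l)) k'E m0 oppr0 -m0 -kE.
  by rewrite (inj_eq (@zidx_inj l)).
rewrite (bigD1 k) //= (bigD1 k') /=; last first.
  by rewrite -(inj_eq (@zidx_inj l)) kE k'E; lia.
by rewrite kE k'E big1 ?addr0 // => p /andP[pk pk']; rewrite T0 ?mul0r.
Qed.

Lemma T_mx_unitary (l : nat) :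
  T_mx R l *m (map_mx Num.conj (T_mx R l))^T = 1%:M.
Proof.
apply/matrixP => j k; rewrite !mxE -(inj_eq (@zidx_inj l)).
under eq_bigr => p _ do rewrite !mxE.
rewrite (sum_T_entry (fun p => Num.conj (T (zidx k) p))) ?zidx_le //.
move: (zidx j) (zidx k) => m n {j k l}.
have [mn|mn] := eqVneq `|m| `|n|; last first.
  rewrite (_ : m == n = false); last by lia.
  case: eqP => [m0|_]; rewrite ?(@T_entry_eq0 n) ?conjC0 ?mulr0 ?addr0 //; lia.
have r0 := sqrt2C_neq0; have r2 := sqrt2C_sqr.
have e2 := signz_sqr m; have i2 := imag_sqr.
case: (ltgtP m 0) => [hm|hm|m0].
- have Tm := T_entry_neg hm; have [->|->] : n = m \/ n = - m by lia.
    rewrite eqxx mulr1n ?Tm.1 ?Tm.2.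
    move: ((-1) ^ m) 'i%C (Num.sqrt 2)%:C r0 r2 e2 i2 => e i r r0 r2 e2 i2.
    by field: e2 r2 i2.
  rewrite (_ : m == - m = false) ?mulr0n ?Tm.1 ?Tm.2; last by lia.
  move: ((-1) ^ m) 'i%C (Num.sqrt 2)%:C r0 r2 e2 i2 => e i r r0 r2 e2 i2.
  by field: e2 r2 i2.
- have Tm := T_entry_pos hm; have [->|->] : n = m \/ n = - m by lia.
    rewrite eqxx mulr1n ?Tm.1 ?Tm.2.
    move: ((-1) ^ m) (Num.sqrt 2)%:C r0 r2 e2 => e r r0 r2 e2.
    by field: e2 r2.
  rewrite (_ : m == - m = false) ?mulr0n ?Tm.1 ?Tm.2; last by lia.
  move: ((-1) ^ m) 'i%C (Num.sqrt 2)%:C r0 r2 e2 i2 => e i r r0 r2 e2 i2.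
  by field: e2 r2 i2.
- by rewrite m0 in mn *; rewrite (_ : n = 0) ?T_entry00 ?conjC1 ?mulr1 //; lia.
Qed.

(** Real harmonics are real: conjugation exchanges Y_l^p and Y_l^{-p} up to the
    sign (-1)^p. *)
Lemma T_entryN (m p : int) : T m (- p) = (-1) ^ p * Num.conj (T m p).
Proof.
have [mp|mp] := eqVneq `|m| `|p|; last first.
  by rewrite !T_entry_eq0 ?conjC0 ?mulr0 ?normrN.
have e2 := signz_sqr m.
case: (ltgtP m 0) => [hm|hm|m0].
- have Tm := T_entry_neg hm; have [->|->] : p = m \/ p = - m by lia.
    by rewrite ?Tm.1 ?Tm.2 mulrA [_ * - _]mulrC.
  by rewrite opprK signzN ?Tm.1 ?Tm.2 mulrA mulrCA e2 mulr1.
- have Tm := T_entry_pos hm; have [->|->] : p = m \/ p = - m by lia.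
    by rewrite ?Tm.1 ?Tm.2 mulrA e2.
  by rewrite opprK signzN ?Tm.1 ?Tm.2 mul1r.
- have -> : p = 0 by lia.
  by rewrite m0 oppr0 T_entry00 conjC1 mulr1.
Qed.
End RealHarmonics.

(** * The Clebsch-Gordan coefficients for real harmonics *)

(** If p1 and p2 are both nonzero then |p1 + p2| and |p1 - p2| differ, so the
    absolute value of the sum fixes the relative sign. *)
Lemma sign_pairs (p1 p2 x1 x2 : int) :
  ~ (p1 = 0 /\ p2 = 0) ->
  `|x1| = `|p1| -> `|x2| = `|p2| -> `|x1 + x2| = `|p1 + p2| ->
  x1 = p1 /\ x2 = p2 \/ x1 = - p1 /\ x2 = - p2.
Proof.
move=> nz e1 e2 e.
have [E1|E1] : x1 = p1 \/ x1 = - p1 by lia.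
  have [E2|E2] : x2 = p2 \/ x2 = - p2 by lia.
    by left.
  by rewrite E1 E2 in e *; lia.
have [E2|E2] : x2 = p2 \/ x2 = - p2 by lia.
  by rewrite E1 E2 in e *; lia.
by right.
Qed.

Section RealCoefficients.
Variables (R : realType) (C : nat -> int -> nat -> int -> nat -> int -> R).
Variables (l1 l2 : nat).
Local Notation d := `|l1 - l2|%N.
Local Notation n := (minn l1 l2).*2.+1.
Local Notation T := (T_entry R).

(** The change of basis on the columns acts on each degree separately. *)
Lemma cg_real_mxE :
  cg_real_mx C l1 l2 =
  (map_mx Num.conj (T_mx R l1) *t map_mx Num.conj (T_mx R l2)) *m
  castmx (erefl, cg_size l1 l2)
    (\mxrow_(k < n) (cg_block C l1 l2 (d + k) *m (T_mx R (d + k))^T)).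
Proof.
by rewrite -(CG_mulmx_blocks C l1 l2 (fun l => (T_mx R l)^T)) mulmxA.
Qed.

Lemma cg_realE (l : nat) (m1 m2 m : int) :
  (`|l1 - l2| <= l <= l1 + l2)%N ->
  `|m1| <= l1%:Z -> `|m2| <= l2%:Z -> `|m| <= l%:Z ->
  cg_real C l m l1 m1 l2 m2 =
  \sum_(p1 < l1.*2.+1) \sum_(p2 < l2.*2.+1) \sum_(p < l.*2.+1)
    Num.conj (T m1 (zidx p1)) * Num.conj (T m2 (zidx p2)) * T m (zidx p)
    * (C l (zidx p) l1 (zidx p1) l2 (zidx p2))%:C.
Proof.
move=> hl /zidx_surj[k1 <-] /zidx_surj[k2 <-] /zidx_surj[j <-].
have hk : (l - d < n)%N by lia.
have lE : (d + Ordinal hk)%N = l by rewrite /=; lia.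
case: _ / lE j => j.
rewrite /cg_real cg_rowE block_colE !absz_nat !valK cg_real_mxE mxE pair_bigA.
rewrite (reindex (@mxtens_index _ _)) /=; last first.
  by exists (@mxtens_unindex _ _) => x _;
    rewrite ?mxtens_indexK ?mxtens_unindexK.
apply: eq_bigr => -[p1 p2] _.
rewrite tensmxE castmx_mxrowE !mxE big_distrr /=.
by apply: eq_bigr => p _; rewrite !mxE mxtens_indexK /= -mulrA [_%:C * _]mulrC.
Qed.

Hypothesis hC : is_clebsch_gordan C.

Lemma cg_real_mx_unitary :
  cg_real_mx C l1 l2 *m (map_mx Num.conj (cg_real_mx C l1 l2))^T = 1%:M.
Proof.
rewrite cg_real_mxE.
set S := castmx _ _; set U := _ *t _.
have SS : S *m (map_mx Num.conj S)^T = 1%:M.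
  rewrite /S map_castmx castmxr_mulmx_tr.
  rewrite (_ : map_mx _ _ = \mxrow_(k < n)
    (cg_block C l1 l2 (d + k) *m (map_mx Num.conj (T_mx R (d + k)))^T));
    last first.
    apply/matrixP => i s; rewrite !mxE rmorph_sum; apply: eq_bigr => k _.
    by rewrite rmorphM !mxE /= conj_realC.
  rewrite tr_mxrow mul_mxrow_mxcol -(CG_mx_orthogonal l1 l2 hC).
  rewrite -[X in X *m _]mulmx1 -(blocks1 R l1 l2) CG_sandwich.
  apply: eq_bigr => k _; rewrite mulmx1 trmx_mul trmxK mulmxA.
  by rewrite -[X in X *m _]mulmxA -[X in _ *m X *m _]trmxK trmx_mul trmxK
     (mulmx1C (T_mx_unitary _ _)) trmx1 mulmx1.
have TT l : map_mx Num.conj (T_mx R l) *m (T_mx R l)^T = 1%:M.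
  by rewrite -[LHS]trmxK trmx_mul trmxK T_mx_unitary trmx1.
have conj2 l : map_mx Num.conj (map_mx Num.conj (T_mx R l)) = T_mx R l.
  by apply/matrixP => i j; rewrite !mxE conjCK.
rewrite map_mxM trmx_mul mulmxA -[X in X *m _]mulmxA SS mulmx1 /U.
by rewrite map_mxT /= !conj2 trmx_tens tensmx_mul !TT tensmx11.
Qed.

(** Here (p1, p2) is a choice of signs for (m1, m2) that is compatible with m.
    The opposite choice is the only other one that contributes, and these two
    differ because (m1, m2) is not (0, 0). *)
Lemma cg_real_two_terms (l : nat) (m1 m2 m p1 p2 : int) :
  (`|l1 - l2| <= l <= l1 + l2)%N ->
  `|m1| <= l1%:Z -> `|m2| <= l2%:Z -> `|m| <= l%:Z ->
  `|p1| = `|m1| -> `|p2| = `|m2| -> `|m| = `|p1 + p2| ->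
  ~ (m1 = 0 /\ m2 = 0) ->
  cg_real C l m l1 m1 l2 m2 =
  (C l (p1 + p2) l1 p1 l2 p2)%:C *
  (Num.conj (T m1 p1) * Num.conj (T m2 p2) * T m (p1 + p2)
   + (-1) ^+ (l1 + l2 - l) * (T m1 p1 * T m2 p2 * Num.conj (T m (p1 + p2)))).
Proof.
move=> hl h1 h2 h e1 e2 e nz; rewrite cg_realE //.
have [k1 k1E] : {k : 'I_l1.*2.+1 | zidx k = p1} by apply: zidx_surj; lia.
have [k2 k2E] : {k : 'I_l2.*2.+1 | zidx k = p2} by apply: zidx_surj; lia.
have [k kE] : {k : 'I_l.*2.+1 | zidx k = p1 + p2} by apply: zidx_surj; lia.
have [k1' k1'E] : {k : 'I_l1.*2.+1 | zidx k = - p1} by apply: zidx_surj; lia.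
have [k2' k2'E] : {k : 'I_l2.*2.+1 | zidx k = - p2} by apply: zidx_surj; lia.
have [k' k'E] : {k : 'I_l.*2.+1 | zidx k = - (p1 + p2)}.
  by apply: zidx_surj; lia.
have nzp : ~ (p1 = 0 /\ p2 = 0) by move=> [E1 E2]; apply: nz; lia.
under eq_bigr => x _ do rewrite pair_bigA.
rewrite pair_bigA (bigD1 (k1, (k2, k))) //= (bigD1 (k1', (k2', k'))) /=;
  last first.
  rewrite !xpair_eqE -(inj_eq (@zidx_inj l1)) -(inj_eq (@zidx_inj l2)).
  rewrite k1E k2E k1'E k2'E; lia.
rewrite big1 ?addr0; last first.
  move=> [x1 [x2 x]] /=; rewrite !xpair_eqE -!(inj_eq (@zidx_inj _)).
  rewrite k1E k2E kE k1'E k2'E k'E => ne.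
  have [e1'|ne1] := eqVneq `|zidx x1| `|m1|; last first.
    by rewrite (@T_entry_eq0 _ m1) ?conjC0 ?mul0r // eq_sym.
  have [e2'|ne2] := eqVneq `|zidx x2| `|m2|; last first.
    by rewrite (@T_entry_eq0 _ m2) ?conjC0 ?mulr0 ?mul0r // eq_sym.
  have [e'|ne'] := eqVneq `|zidx x| `|m|; last first.
    by rewrite (@T_entry_eq0 _ m) ?conjC0 ?mulr0 ?mul0r // eq_sym.
  have [xE|nx] := eqVneq (zidx x) (zidx x1 + zidx x2); last first.
    by rewrite (clebsch_gordan_selection hC) ?mulr0 ?zidx_le.
  rewrite xE in e' ne; case/andP: ne => ne ne'.
  have [] := sign_pairs nzp (etrans e1' (esym e1)) (etrans e2' (esym e2))
                         (etrans e' e).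
  - by move=> [E1 E2]; rewrite E1 E2 !eqxx in ne.
  - by move=> [E1 E2]; rewrite E1 E2 opprD !eqxx in ne'.
rewrite k1E k2E kE k1'E k2'E k'E (clebsch_gordan_symmetry hC) //; try lia.
rewrite !T_entryN !rmorphM /= !conjCK !conj_signz rmorphXn rmorphN1.
rewrite signzD.
have collect (u v s c a1 a2 a b1 b2 b : R[i]) : u * u = 1 -> v * v = 1 ->
    a1 * a2 * b * c + u * b1 * (v * b2) * (u * v * a) * (s * c) =
    c * (a1 * a2 * b + s * (b1 * b2 * a)) by move=> uu vv; ring: uu vv.
exact: collect (signz_sqr R p1) (signz_sqr R p2).
Qed.

Lemma cg_real00 (l : nat) :
  (`|l1 - l2| <= l <= l1 + l2)%N ->
  cg_real C l 0 l1 0 l2 0 = (C l 0 l1 0 l2 0)%:C.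
Proof.
move=> hl; rewrite cg_realE //; have T0 p : p != 0 -> T 0 p = 0.
  by move=> p0; apply: T_entry_eq0; lia.
have [k1 k1E] : {k : 'I_l1.*2.+1 | zidx k = 0} by apply: zidx_surj; lia.
have [k2 k2E] : {k : 'I_l2.*2.+1 | zidx k = 0} by apply: zidx_surj; lia.
have [k kE] : {k : 'I_l.*2.+1 | zidx k = 0} by apply: zidx_surj; lia.
have nz l' (x y : 'I_l'.*2.+1) : zidx y = 0 -> x != y -> zidx x != 0.
  by move=> <-; rewrite (inj_eq (@zidx_inj l')).
rewrite (big_only (i0 := k1)); last first.
  move=> x /(nz _ _ _ k1E) x0; apply: big1 => y _; apply: big1 => z _.
  by rewrite T0 // conjC0 !mul0r.
rewrite (big_only (i0 := k2)); last first.
  move=> y /(nz _ _ _ k2E) y0; apply: big1 => z _.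
  by rewrite [T 0 (zidx y)]T0 // conjC0 mulr0 !mul0r.
rewrite (big_only (i0 := k)); last first.
  by move=> z /(nz _ _ _ kE) z0; rewrite [T 0 (zidx z)]T0 // mulr0 mul0r.
by rewrite k1E k2E kE T_entry00 conjC1 !mul1r.
Qed.

Lemma cg_real_eq0 (l : nat) (m1 m2 m : int) :
  (`|l1 - l2| <= l <= l1 + l2)%N ->
  `|m1| <= l1%:Z -> `|m2| <= l2%:Z -> `|m| <= l%:Z ->
  `|m| <> `|m1 + m2| -> `|m| <> `|m1 - m2| -> cg_real C l m l1 m1 l2 m2 = 0.
Proof.
move=> hl h1 h2 h ne ne'; rewrite cg_realE //.
apply: big1 => x1 _; apply: big1 => x2 _; apply: big1 => x _.
have [e1|ne1] := eqVneq `|zidx x1| `|m1|; last first.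
  by rewrite (@T_entry_eq0 _ m1) ?conjC0 ?mul0r // eq_sym.
have [e2|ne2] := eqVneq `|zidx x2| `|m2|; last first.
  by rewrite (@T_entry_eq0 _ m2) ?conjC0 ?mulr0 ?mul0r // eq_sym.
have [e|nem] := eqVneq `|zidx x| `|m|; last first.
  by rewrite (@T_entry_eq0 _ m) ?conjC0 ?mulr0 ?mul0r // eq_sym.
rewrite (clebsch_gordan_selection hC) ?mulr0 ?zidx_le //.
apply/eqP => xE; rewrite xE in e.
move: (zidx x1) (zidx x2) e1 e2 e => y1 y2 e1 e2 e {xE}.
have [E1|E1] : y1 = m1 \/ y1 = - m1 by lia.
  by have [E2|E2] : y2 = m2 \/ y2 = - m2; [lia|..]; rewrite E1 E2 in e; lia.
by have [E2|E2] : y2 = m2 \/ y2 = - m2; [lia|..]; rewrite E1 E2 in e; lia.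
Qed.
Lemma cg_real_sum (l : nat) (m1 m2 : int) :
  (`|l1 - l2| <= l <= l1 + l2)%N ->
  `|m1| <= l1%:Z -> `|m2| <= l2%:Z -> `|m1 + m2| <= l%:Z ->
  ~ (m1 = 0 /\ m2 = 0) ->
  let a := (C l (m1 + m2) l1 m1 l2 m2)%:C in
  let s : R[i] := (-1) ^+ (l1 + l2 - l) in
  let M := m1 + m2 in
  (cg_real C l (m1 + m2) l1 m1 l2 m2, cg_real C l (- m1 - m2) l1 m1 l2 m2) =
  (a * (Num.conj (T m1 m1) * Num.conj (T m2 m2) * T M M
        + s * (T m1 m1 * T m2 m2 * Num.conj (T M M))),
   a * (Num.conj (T m1 m1) * Num.conj (T m2 m2) * T (- M) M
        + s * (T m1 m1 * T m2 m2 * Num.conj (T (- M) M)))).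
Proof.
move=> hl h1 h2 h nz /=; rewrite -opprD.
by congr pair; apply: cg_real_two_terms; rewrite ?normrN.
Qed.

Lemma cg_real_diff (l : nat) (m1 m2 : int) :
  (`|l1 - l2| <= l <= l1 + l2)%N ->
  `|m1| <= l1%:Z -> `|m2| <= l2%:Z -> `|m1 - m2| <= l%:Z ->
  ~ (m1 = 0 /\ m2 = 0) ->
  let b := (C l (m1 - m2) l1 m1 l2 (- m2))%:C in
  let s : R[i] := (-1) ^+ (l1 + l2 - l) in
  let M := m1 - m2 in
  (cg_real C l (m1 - m2) l1 m1 l2 m2, cg_real C l (- m1 + m2) l1 m1 l2 m2) =
  (b * (Num.conj (T m1 m1) * Num.conj (T m2 (- m2)) * T M M
        + s * (T m1 m1 * T m2 (- m2) * Num.conj (T M M))),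
   b * (Num.conj (T m1 m1) * Num.conj (T m2 (- m2)) * T (- M) M
        + s * (T m1 m1 * T m2 (- m2) * Num.conj (T (- M) M)))).
Proof.
move=> hl h1 h2 h nz /=.
have -> : - m1 + m2 = - (m1 - m2) by rewrite opprB addrC.
by congr pair; apply: cg_real_two_terms; rewrite ?normrN.
Qed.
End RealCoefficients.

(** * The table of values *)

Ltac T_values v1 v2 v3 :=
  rewrite ?v1.1 ?v2.1 ?v3.1 ?v1.2 ?v2.2 ?v3.2 ?signzD ?signzN.

(** The remaining identity is polynomial in the signs s, (-1)^m1, (-1)^m2, in i
    and in sqrt 2, modulo the squares of the last four. Replacing these by
    variables keeps [field] from looking inside them. *)
Ltac close_case R m1 m2 s :=
  rewrite ?sqrt8C -/s;
  let i2 := fresh "i2" in let u2 := fresh "u2" in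
  let v2 := fresh "v2" in let r2 := fresh "r2" in
  move: (s) ((-1) ^ m1) ((-1) ^ m2) 'i%C (Num.sqrt 2)%:C
    (imag_sqr R) (signz_sqr R m1) (signz_sqr R m2)
    (sqrt2C_neq0 R) (sqrt2C_sqr R)
    => s' u v i r i2 u2 v2 r0 r2;
  congr pair; congr (_ * _); field: i2 u2 v2 r2.

Theorem theorem4 (R : realType)
    (C : nat -> int -> nat -> int -> nat -> int -> R)
    (hC : is_clebsch_gordan C) (l1 l2 : nat) :
  (cg_real_mx C l1 l2 *m (map_mx Num.conj (cg_real_mx C l1 l2))^T = 1%:M)
  /\
  (forall (m1 m2 : int) (l : nat) (m : int),
     `|m1| <= l1%:Z -> `|m2| <= l2%:Z ->
     (`|l1 - l2| <= l <= l1 + l2)%N -> `|m| <= l%:Z ->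
     `|m| <> `|m1 + m2| -> `|m| <> `|m1 - m2| ->
     cg_real C l m l1 m1 l2 m2 = 0)
  /\
  (forall (m1 m2 : int) (l : nat),
     `|m1| <= l1%:Z -> `|m2| <= l2%:Z ->
     let eta : R[i] := (-1) ^+ (l1 + l2 - l)%N + 1 in
     let zeta : R[i] := (-1) ^+ (l1 + l2 - l)%N - 1 in
     let r8 : R[i] := (Num.sqrt 8)%:C in
     let a : R[i] := (C l (m1 + m2) l1 m1 l2 m2)%:C in
     let b : R[i] := (C l (m1 - m2) l1 m1 l2 (- m2))%:C in
     let ca := (cg_real C l (m1 + m2) l1 m1 l2 m2,
                cg_real C l (- m1 - m2) l1 m1 l2 m2) in
     let cb := (cg_real C l (m1 - m2) l1 m1 l2 m2,
                cg_real C l (- m1 + m2) l1 m1 l2 m2) in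
     ((maxn `|l1 - l2| (absz (m1 + m2)%R) <= l <= l1 + l2)%N ->
        (m1 = 0 -> m2 = 0 -> ca = (a * 1, a * 1))
        /\
        (m1 = 0 /\ m2 <> 0 \/ m1 <> 0 /\ m2 = 0 ->
           ca = (a * (1 / 2 * eta), a * ('i%C / 2 * zeta)))
        /\
        (0 < m1 -> 0 < m2 ->
           ca = (a * (1 / r8 * eta), a * ('i%C / r8 * zeta)))
        /\
        (m1 < 0 -> 0 < m2 -> 0 < m1 + m2 ->
           ca = (a * ('i%C * (-1) ^ m1 / r8 * zeta),
                 a * (- ((-1) ^ m1 / r8) * eta)))
        /\
        (m1 < 0 -> 0 < m2 -> m1 + m2 = 0 ->
           ca = (a * ('i%C * (-1) ^ m1 / 2 * zeta),
                 a * ('i%C * (-1) ^ m1 / 2 * zeta)))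
        /\
        (m1 < 0 -> 0 < m2 -> m1 + m2 < 0 ->
           ca = (a * ((-1) ^ m2 / r8 * eta),
                 a * ('i%C * (-1) ^ m2 / r8 * zeta)))
        /\
        (m1 < 0 -> m2 < 0 ->
           ca = (a * ('i%C / r8 * zeta), a * (- (1 / r8) * eta)))
        /\
        (0 < m1 -> m2 < 0 -> m1 + m2 < 0 ->
           ca = (a * ((-1) ^ m1 / r8 * eta),
                 a * ('i%C * (-1) ^ m1 / r8 * zeta)))
        /\
        (0 < m1 -> m2 < 0 -> m1 + m2 = 0 ->
           ca = (a * ('i%C * (-1) ^ m1 / 2 * zeta),
                 a * ('i%C * (-1) ^ m1 / 2 * zeta)))
        /\
        (0 < m1 -> m2 < 0 -> 0 < m1 + m2 ->
           ca = (a * ('i%C * (-1) ^ m2 / r8 * zeta),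
                 a * (- ((-1) ^ m2 / r8) * eta))))
     /\
     ((maxn `|l1 - l2| (absz (m1 - m2)%R) <= l <= l1 + l2)%N ->
        (m1 = 0 -> m2 = 0 -> cb = (b * 1, b * 1))
        /\
        (m1 <> 0 -> m2 = 0 ->
           cb = (b * (1 / 2 * eta), b * ('i%C / 2 * zeta)))
        /\
        (m1 = 0 -> m2 <> 0 ->
           cb = (b * (- ('i%C / 2) * zeta), b * (1 / 2 * eta)))
        /\
        (0 < m1 -> 0 < m2 -> 0 < m1 - m2 ->
           cb = (b * ((-1) ^ m2 / r8 * eta),
                 b * ('i%C * (-1) ^ m2 / r8 * zeta)))
        /\
        (0 < m1 -> 0 < m2 -> m1 - m2 = 0 ->
           cb = (b * ((-1) ^ m1 / 2 * eta), b * ((-1) ^ m1 / 2 * eta)))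
        /\
        (0 < m1 -> 0 < m2 -> m1 - m2 < 0 ->
           cb = (b * (- ('i%C * (-1) ^ m1 / r8) * zeta),
                 b * ((-1) ^ m1 / r8 * eta)))
        /\
        (m1 < 0 -> 0 < m2 ->
           cb = (b * (1 / r8 * eta), b * ('i%C / r8 * zeta)))
        /\
        (m1 < 0 -> m2 < 0 -> m1 - m2 < 0 ->
           cb = (b * (- ('i%C * (-1) ^ m2 / r8) * zeta),
                 b * ((-1) ^ m2 / r8 * eta)))
        /\
        (m1 < 0 -> m2 < 0 -> m1 - m2 = 0 ->
           cb = (b * ((-1) ^ m1 / 2 * eta), b * ((-1) ^ m1 / 2 * eta)))
        /\
        (m1 < 0 -> m2 < 0 -> 0 < m1 - m2 ->
           cb = (b * ((-1) ^ m1 / r8 * eta),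
                 b * ('i%C * (-1) ^ m1 / r8 * zeta)))
        /\
        (0 < m1 -> m2 < 0 ->
           cb = (b * (- ('i%C / r8) * zeta), b * (1 / r8 * eta))))).
Proof.
split; first exact: cg_real_mx_unitary.
split; first by move=> m1 m2 l m h1 h2 hl hm; exact: cg_real_eq0.
move=> m1 m2 l h1 h2 eta zeta r8 a b ca cb.
have pos := T_entry_pos R; have neg := T_entry_neg R.
pose s : R[i] := (-1) ^+ (l1 + l2 - l).
split=> hl.
- have hl' : (`|l1 - l2| <= l <= l1 + l2)%N by lia.
  have hM : `|m1 + m2| <= l%:Z by lia.
  have caE := cg_real_sum hC hl' h1 h2 hM; rewrite /= -/a -/ca in caE.
  rewrite /eta /zeta /r8; do !split.
  + by move=> z1 z2; rewrite /ca /a z1 z2 ?(oppr0, addr0) cg_real00 ?mulr1.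
  + move=> z; have [[z1 nz]|[nz z2]] := z; (rewrite caE; last by lia).
    * rewrite z1 add0r T_entry00 conjC1.
      have [p2|p2] : 0 < m2 \/ m2 < 0 by lia.
        by T_values (pos _ p2) (pos _ p2) (pos _ p2); close_case R m1 m2 s.
      by T_values (neg _ p2) (neg _ p2) (neg _ p2); close_case R m1 m2 s.
    * rewrite z2 addr0 T_entry00 conjC1.
      have [p1|p1] : 0 < m1 \/ m1 < 0 by lia.
        by T_values (pos _ p1) (pos _ p1) (pos _ p1); close_case R m1 m2 s.
      by T_values (neg _ p1) (neg _ p1) (neg _ p1); close_case R m1 m2 s.
  + move=> p1 p2; have p : 0 < m1 + m2 by lia.
    rewrite caE; last by lia.
    T_values (pos _ p1) (pos _ p2) (pos _ p).
    by close_case R m1 m2 s.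
  + move=> p1 p2 p.
    rewrite caE; last by lia.
    T_values (neg _ p1) (pos _ p2) (pos _ p).
    by close_case R m1 m2 s.
  + move=> p1 p2 p.
    rewrite caE; last by lia.
    rewrite p oppr0 T_entry00 conjC1.
    T_values (neg _ p1) (pos _ p2) (pos _ p2).
    have m2E : m2 = - m1 by lia.
    by rewrite ?m2E ?signzN; close_case R m1 m2 s.
  + move=> p1 p2 p.
    rewrite caE; last by lia.
    T_values (neg _ p1) (pos _ p2) (neg _ p).
    by close_case R m1 m2 s.
  + move=> p1 p2; have p : m1 + m2 < 0 by lia.
    rewrite caE; last by lia.
    T_values (neg _ p1) (neg _ p2) (neg _ p).
    by close_case R m1 m2 s.
  + move=> p1 p2 p.
    rewrite caE; last by lia.
    T_values (pos _ p1) (neg _ p2) (neg _ p).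
    by close_case R m1 m2 s.
  + move=> p1 p2 p.
    rewrite caE; last by lia.
    rewrite p oppr0 T_entry00 conjC1.
    T_values (pos _ p1) (neg _ p2) (neg _ p2).
    have m2E : m2 = - m1 by lia.
    by rewrite ?m2E ?signzN; close_case R m1 m2 s.
  + move=> p1 p2 p.
    rewrite caE; last by lia.
    T_values (pos _ p1) (neg _ p2) (pos _ p).
    by close_case R m1 m2 s.
- have hl' : (`|l1 - l2| <= l <= l1 + l2)%N by lia.
  have hM : `|m1 - m2| <= l%:Z by lia.
  have cbE := cg_real_diff hC hl' h1 h2 hM; rewrite /= -/b -/cb in cbE.
  rewrite /eta /zeta /r8; do !split.
  + by move=> z1 z2; rewrite /cb /b z1 z2 ?(oppr0, addr0) cg_real00 ?mulr1.
  + move=> nz z2; rewrite cbE; last by lia.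
    rewrite z2 subr0 oppr0 T_entry00 conjC1.
    have [p1|p1] : 0 < m1 \/ m1 < 0 by lia.
      by T_values (pos _ p1) (pos _ p1) (pos _ p1); close_case R m1 m2 s.
    by T_values (neg _ p1) (neg _ p1) (neg _ p1); close_case R m1 m2 s.
  + move=> z1 nz; rewrite cbE; last by lia.
    rewrite z1 sub0r opprK T_entry00 conjC1.
    have [p2|p2] : 0 < m2 \/ m2 < 0 by lia.
      by T_values (pos _ p2) (pos _ p2) (pos _ p2); close_case R m1 m2 s.
    by T_values (neg _ p2) (neg _ p2) (neg _ p2); close_case R m1 m2 s.
  + move=> p1 p2 p.
    rewrite cbE; last by lia.
    T_values (pos _ p1) (pos _ p2) (pos _ p).
    by close_case R m1 m2 s.
  + move=> p1 p2 p.
    rewrite cbE; last by lia.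
    rewrite p oppr0 T_entry00 conjC1.
    T_values (pos _ p1) (pos _ p2) (pos _ p2).
    have m2E : m2 = m1 by lia.
    by rewrite ?m2E; close_case R m1 m2 s.
  + move=> p1 p2 p.
    rewrite cbE; last by lia.
    T_values (pos _ p1) (pos _ p2) (neg _ p).
    by close_case R m1 m2 s.
  + move=> p1 p2; have p : m1 - m2 < 0 by lia.
    rewrite cbE; last by lia.
    T_values (neg _ p1) (pos _ p2) (neg _ p).
    by close_case R m1 m2 s.
  + move=> p1 p2 p.
    rewrite cbE; last by lia.
    T_values (neg _ p1) (neg _ p2) (neg _ p).
    by close_case R m1 m2 s.
  + move=> p1 p2 p.
    rewrite cbE; last by lia.
    rewrite p oppr0 T_entry00 conjC1.
    T_values (neg _ p1) (neg _ p2) (neg _ p2).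
    have m2E : m2 = m1 by lia.
    by rewrite ?m2E; close_case R m1 m2 s.
  + move=> p1 p2 p.
    rewrite cbE; last by lia.
    T_values (neg _ p1) (neg _ p2) (pos _ p).
    by close_case R m1 m2 s.
  + move=> p1 p2; have p : 0 < m1 - m2 by lia.
    rewrite cbE; last by lia.
    T_values (pos _ p1) (neg _ p2) (pos _ p).
    by close_case R m1 m2 s.
Qed.
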